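(* Let $(X,\Pi)$ be a $(\delta,\gamma)$-eposet with $\gamma \leq O\left(\frac{\max_i\{\delta_i(1-\delta_{i-1})\}}{k^5R^2_{\text{max}}}\right)$. If $f \in C_k$ has HD-Level-Set Decomposition $f=f_0+\ldots+f_k$, then for any $\ell \leq k$, $\mathrm{Var}(D^k_\ell f)$ is controlled by its projection onto $V_k^0 \oplus \ldots \oplus V_k^\ell$ in the following sense: \begin{align*} \mathrm{Var}(D^k_\ell f) &\in \sum\limits_{j=1}^\ell \lambda_j(\check{N}_k^{k-\ell})\langle f, f_j \rangle \pm c_k\gamma \|f\|^2, \end{align*} where $c_k \leq O(k^{5/2}R_{\text{max}})$ and $\lambda_j(\check{N}_k^{k-\ell}) = \prod_{s=1}^{k-\ell}(1-\delta^{k-s}_{k-s-j})$.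
   Context: $(X,\Pi)$ is a $d$-dimensional regular graded poset (every element of $X(k)$ lies above exactly $R(k,i)$ elements of $X(i)$; $R_{\max}=\max_{0\le i\le k}R(k,i)$) with measure induced from the top level, assumed $\gamma$-non-lazy (maximum laziness of each lower walk $U_{i-1}D_i$ at most $\gamma$). $C_k$ is the space of functions $X(k)\to\mathbb{R}$ with inner product $\langle f,g\rangle=\sum_{\tau\in X(k)}\pi_k(\tau)f(\tau)g(\tau)$ and $\|f\|^2=\langle f,f\rangle$. Up/down operators: $U_if(y)=\frac{1}{R(i+1,i)}\sum_{x\lessdot y}f(x)$, $D_{i+1}f(x)=\frac{1}{\pi_{i+1}(X_x)}\sum_{y\gtrdot x}\pi_{i+1}(y)f(y)$, $U^k_\ell=U_{k-1}\cdots U_\ell$, $D^k_\ell=D_{\ell+1}\cdots D_k$. $(\delta,\gamma)$-eposet means $\|D_{i+1}U_i-(1-\delta_i)I-\delta_iU_{i-1}D_i\|\le\gamma$ for $1\le i\le d-1$. HD-Level-Set Decomposition: $H^0=C_0$, $H^i=\mathrm{Ker}(D_i)$, $V^i_k=U^k_iH^i$, $C_k=V^0_k\oplus\cdots\oplus V^k_k$, and $f_i\in V^i_k$. The canonical lower walk is $\check{N}_k^{k-\ell}=U^k_\ell D^k_\ell$. Notation: $\delta^k_j=\prod_{i=k-j}^k\delta_i$, with $\delta^k_{-1}=1$ and $\delta^k_i=1$ for $i<0$. $\mathrm{Var}$ is taken with respect to $\pi_\ell$. *)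

(* Defs.v *)
From HB Require Import structures.
From mathcomp Require Import all_boot all_order all_algebra.
From mathcomp Require Import boolp classical_sets reals exp.

Set Implicit Arguments.
Unset Strict Implicit.
Unset Printing Implicit Defensive.

Import Order.TTheory GRing.Theory Num.Theory.
Local Open Scope ring_scope.

Definition covers (disp : Order.disp_t) (X : finPOrderType disp) (x y : X) : bool :=
  (x < y)%O && [forall z : X, ~~ ((x < z)%O && (z < y)%O)].

(* A regular measured poset: a finite pure graded poset with a unique face of
   rank 0, whose faces of rank k lie above exactly [reg k i] faces of rank i,
   with a probability distribution of full support on the top level.  The
   distributions pi_0, ..., pi_d are packed in one function: pi_i is the
   restriction of [wt] to the faces of rank i.
   Uniqueness of the face of rank 0 is a standing assumption on these posets;
   it is what makes f_0 the constant part of f, hence absent from the variance.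
   Full support is needed for <f,g> to be an inner product and for the down
   operators to be defined. *)
Record regular_poset (R : realType) (disp : Order.disp_t)
    (X : finPOrderType disp) := RegularPoset {
  rk : X -> nat;
  pdim : nat;
  reg : nat -> nat -> nat;
  wt : X -> R;
  rk_lt : forall x y : X, (x < y)%O -> (rk x < rk y)%N;
  rk_covers : forall x y : X, covers x y -> rk y = (rk x).+1;
  rk_maximal : forall x : X, (forall y : X, ~~ (x < y)%O) -> rk x = pdim;
  card_rk0 : #|[pred x | rk x == 0%N]| = 1%N;
  regP : forall (i : nat) (x : X), (i <= rk x)%N ->
    #|[pred y | (rk y == i) && (y <= x)%O]| = reg (rk x) i;
  wt_gt0 : forall x : X, rk x = pdim -> 0 < wt x;
  wt_sum1 : \sum_(x | rk x == pdim) wt x = 1;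
  wt_induced : forall x : X, (rk x < pdim)%N ->
    wt x = (reg (rk x).+1 (rk x))%:R^-1 * \sum_(y | covers x y) wt y
}.

(* C_k, the functions X(k) -> R, is represented as the space of functions on X
   that vanish outside X(k). *)
Definition Ck (R : realType) (disp : Order.disp_t) (X : finPOrderType disp)
    (P : regular_poset R X) (k : nat) (f : {ffun X -> R}) : Prop :=
  forall x : X, rk P x <> k -> f x = 0.

Definition ip (R : realType) (disp : Order.disp_t) (X : finPOrderType disp)
    (P : regular_poset R X) (k : nat) (f g : {ffun X -> R}) : R :=
  \sum_(x | rk P x == k) wt P x * f x * g x.

Definition nrm (R : realType) (disp : Order.disp_t) (X : finPOrderType disp)
    (P : regular_poset R X) (k : nat) (f : {ffun X -> R}) : R :=
  Num.sqrt (ip P k f f).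

Definition opnorm (R : realType) (disp : Order.disp_t) (X : finPOrderType disp)
    (P : regular_poset R X) (k : nat) (A : {ffun X -> R} -> {ffun X -> R}) : R :=
  sup (fun r : R => exists f : {ffun X -> R},
         [/\ Ck P k f, nrm P k f <= 1 & r = nrm P k (A f)]).

Definition expectation (R : realType) (disp : Order.disp_t)
    (X : finPOrderType disp) (P : regular_poset R X) (k : nat)
    (f : {ffun X -> R}) : R :=
  \sum_(x | rk P x == k) wt P x * f x.

Definition variance (R : realType) (disp : Order.disp_t)
    (X : finPOrderType disp) (P : regular_poset R X) (k : nat)
    (f : {ffun X -> R}) : R :=
  \sum_(x | rk P x == k) wt P x * (f x - expectation P k f) ^+ 2.

(* U_i : C_i -> C_(i+1) *)
Definition Uop (R : realType) (disp : Order.disp_t) (X : finPOrderType disp)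
    (P : regular_poset R X) (i : nat) (f : {ffun X -> R}) : {ffun X -> R} :=
  [ffun y => if rk P y == i.+1
             then (reg P i.+1 i)%:R^-1 * \sum_(x | covers x y) f x
             else 0].

(* D_i : C_i -> C_(i-1), for i >= 1 *)
Definition Dop (R : realType) (disp : Order.disp_t) (X : finPOrderType disp)
    (P : regular_poset R X) (i : nat) (f : {ffun X -> R}) : {ffun X -> R} :=
  [ffun x => if (rk P x).+1 == i
             then (\sum_(y | covers x y) wt P y)^-1
                  * \sum_(y | covers x y) wt P y * f y
             else 0].

(* U^k_l = U_(k-1) ... U_l *)
Definition Upow (R : realType) (disp : Order.disp_t) (X : finPOrderType disp)
    (P : regular_poset R X) (k l : nat) (f : {ffun X -> R}) : {ffun X -> R} :=
  foldl (fun g i => Uop P i g) f (iota l (k - l)).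

(* D^k_l = D_(l+1) ... D_k *)
Definition Dpow (R : realType) (disp : Order.disp_t) (X : finPOrderType disp)
    (P : regular_poset R X) (k l : nat) (f : {ffun X -> R}) : {ffun X -> R} :=
  foldr (fun i g => Dop P i g) f (iota l.+1 (k - l)).

Definition indicator (R : realType) (disp : Order.disp_t)
    (X : finPOrderType disp) (x : X) : {ffun X -> R} :=
  [ffun y => (y == x)%:R].

(* The laziness of the lower walk U_(i-1) D_i at x is its probability of
   staying at x. *)
Definition non_lazy (R : realType) (disp : Order.disp_t)
    (X : finPOrderType disp) (P : regular_poset R X) (gamma : R) : Prop :=
  forall (i : nat) (x : X), (1 <= i <= pdim P)%N -> rk P x = i ->
    Uop P i.-1 (Dop P i (indicator R x)) x <= gamma.

(* The parameters are delta_1, ..., delta_(d-1) in [0,1].  Setting delta_0 = 0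
   extends the defining relation to i = 0, where D_1 U_0 is the identity. *)
Definition eposet (R : realType) (disp : Order.disp_t) (X : finPOrderType disp)
    (P : regular_poset R X) (delta : nat -> R) (gamma : R) : Prop :=
  [/\ delta 0%N = 0,
      forall i : nat, (1 <= i < pdim P)%N -> 0 <= delta i <= 1
    & forall i : nat, (1 <= i < pdim P)%N ->
      opnorm P i (fun f => [ffun x => Dop P i.+1 (Uop P i f) x
                                      - (1 - delta i) * f x
                                      - delta i * Uop P i.-1 (Dop P i f) x])
      <= gamma].

Definition Hi (R : realType) (disp : Order.disp_t) (X : finPOrderType disp)
    (P : regular_poset R X) (i : nat) (g : {ffun X -> R}) : Prop :=
  Ck P i g /\ ((0 < i)%N -> Dop P i g = [ffun=> 0]).

Definition Vik (R : realType) (disp : Order.disp_t) (X : finPOrderType disp)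
    (P : regular_poset R X) (k i : nat) (f : {ffun X -> R}) : Prop :=
  exists2 g : {ffun X -> R}, Hi P i g & f = Upow P k i g.

Definition HD_level_set_decomposition (R : realType) (disp : Order.disp_t)
    (X : finPOrderType disp) (P : regular_poset R X) (k : nat)
    (f : {ffun X -> R}) (fs : nat -> {ffun X -> R}) : Prop :=
  (forall i : nat, (i <= k)%N -> Vik P k i (fs i)) /\
  f = \sum_(i < k.+1) fs i.

Definition Rmax (R : realType) (disp : Order.disp_t) (X : finPOrderType disp)
    (P : regular_poset R X) (k : nat) : nat :=
  \max_(i < k.+1) reg P k i.

(* delta^k_j is the product of delta_(k-j), ..., delta_k; it is 1 for j < 0. *)
Definition delta_prod (R : realType) (delta : nat -> R) (k : nat) (j : int) : R :=
  if j is Posz n then \prod_(k - n <= i < k.+1) delta i else 1.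

(* lambda_j of the canonical lower walk U^k_l D^k_l *)
Definition lambda_lower (R : realType) (delta : nat -> R) (k l j : nat) : R :=
  \prod_(1 <= s < (k - l).+1)
    (1 - delta_prod delta (k - s) ((k - s)%N%:Z - j%:Z)).

Definition max_delta (R : realType) (delta : nat -> R) (d : nat) : R :=
  \big[Num.max/0]_(1 <= i < d) (delta i * (1 - delta i.-1)).

(* Main.v *)
(** For [g] in [Ker D_i], moving one [D] through a chain of [U]'s gives
    [D^k_l U^k_i g = rate * U^l_i g] up to [k^2 gamma |g|].  If [f_j = U^k_j g_j],
    then [f_0] is the constant [E f], so [Var (D^k_l f)] is exactly the sum over
    [j >= 1] of [<D^k_l f, D^k_l f_j>], and the total error is at most
    [k^2 gamma |f|] times the sum of the [|g_j|].

    To bound this sum by [sqrt k * Rmax * |f|] one needs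
    [|g_j|^2 <= O(Rmax) |f_j|^2], that is a lower bound on [rate] at [l = i = j].
    It comes from testing on the indicators of the faces [x] of rank [j]:
    non-laziness says that [D_j 1_x] is small, so [|U^k_j 1_x|^2] is at most about
    [rate * |1_x|^2], while by Cauchy-Schwarz the sum over [x] of [|U^k_j 1_x|^2]
    is at least [1 / R(k,j)]. *)
Require Import Defs.
From mathcomp Require Import all_boot all_order all_algebra.
From mathcomp Require Import ring lra zify.
From mathcomp Require Import boolp classical_sets reals exp.

Set Implicit Arguments.
Unset Strict Implicit.
Unset Printing Implicit Defensive.

Import Order.TTheory GRing.Theory Num.Theory.
Local Open Scope ring_scope.

(** * Ranks, weights and linearity of the operators *)

Section Poset.
Context (R : realType) (disp : Order.disp_t) (X : finPOrderType disp)
  (P : regular_poset R X).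

Lemma covers_le_rk (x y : X) :
  rk P y = (rk P x).+1 -> covers x y = (x <= y)%O.
Proof.
move=> rk_y; apply/idP/idP => [/andP[/ltW //]|le_xy].
apply/andP; split.
  by rewrite lt_neqAle le_xy andbT; apply/eqP => xy; move: rk_y; rewrite xy; lia.
apply/forallP => z; apply/negP => /andP[/(rk_lt P) xz /(rk_lt P) zy]; lia.
Qed.

(** Among the faces above [x], one of minimal rank is a cover, since ranks increase strictly. *)
Lemma exists_cover (x : X) : rk P x != pdim P -> exists y, covers x y.
Proof.
move=> rk_x.
have [z xz] : exists z, (x < z)%O.
  apply/existsP; apply: contra_neqT rk_x; rewrite negb_exists => /forallP nox.
  exact: rk_maximal.
case: (@arg_minnP _ z (fun z => (x < z)%O) (rk P) xz) => y xy miny.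
exists y; apply/andP; split=> //; apply/forallP => w.
apply/negP => /andP[/miny + /(rk_lt P)]; lia.
Qed.

Lemma exists_rk (i : nat) : (i <= pdim P)%N -> exists x, rk P x = i.
Proof.
elim: i => [_|i IHi lt_i].
  have := card_rk0 P; case: (pickP [pred x | rk P x == 0%N]) => [x /eqP rx _|n0].
    by exists x.
  by rewrite eq_card0.
have [x rx] := IHi (ltnW lt_i).
have [|y /(rk_covers P) ry] := @exists_cover x; first by rewrite rx ltn_eqF.
by exists y; rewrite ry rx.
Qed.

Lemma card_covers (i : nat) (y : X) :
  rk P y = i.+1 -> #|[pred x | covers x y]| = reg P i.+1 i.
Proof.
move=> ry; rewrite -ry -regP ?ry //; apply: eq_card => x; rewrite !inE.
apply/idP/andP => [xy|[/eqP rx le_xy]]; last by rewrite covers_le_rk ?rx.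
have := rk_covers P xy; rewrite ry => -[<-]; split=> //.
by case/andP: xy => /ltW.
Qed.

Lemma reg_gt0 (i : nat) : (i < pdim P)%N -> (0 < reg P i.+1 i)%N.
Proof.
move=> lt_i; have [x rx] := exists_rk (ltnW lt_i).
have [|y xy] := @exists_cover x; first by rewrite rx ltn_eqF.
have ry := rk_covers P xy; rewrite rx in ry.
by rewrite -(card_covers ry); apply/card_gt0P; exists x; rewrite inE.
Qed.

(** Descend along covers: by [reg_gt0] every face of positive rank covers some face. *)
Lemma exists_below (l : nat) (y : X) : (l <= rk P y <= pdim P)%N ->
  exists2 x, rk P x = l & (x <= y)%O.
Proof.
have [n] := ubnP (rk P y); elim: n y => // n IHn y le_n /andP[].
rewrite leq_eqVlt => /predU1P[->|]; first by exists y.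
case ry: (rk P y) le_n => [//|i] le_n lt_l lt_i.
have : (0 < #|[pred x | covers x y]|)%N by rewrite (card_covers ry) reg_gt0.
case/card_gt0P => x; rewrite inE => xy.
have rx : rk P x = i by have := rk_covers P xy; rewrite ry => -[].
have [||z rz zx] := IHn x; first by rewrite rx.
  by rewrite rx -ltnS lt_l ltnW.
by exists z => //; case/andP: xy => /ltW xy _; apply: le_trans xy.
Qed.

Lemma reg_le_gt0 (k l : nat) : (l <= k <= pdim P)%N -> (0 < reg P k l)%N.
Proof.
move=> /andP[le_l le_k]; have [y ry] := exists_rk le_k.
have [|x rx xy] := @exists_below l y; first by rewrite ry le_l.
rewrite -ry -regP ?ry //; apply/card_gt0P; exists x.
by rewrite inE rx eqxx.
Qed.

(** Positivity is given at the top; induction on the codimension carries it down, since [wt_induced]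
    is a positive combination over a nonempty set of covers. *)
Lemma weight_gt0 (x : X) : (rk P x <= pdim P)%N -> 0 < wt P x.
Proof.
have [n] := ubnP (pdim P - rk P x); elim: n x => // n IHn x le_n.
rewrite leq_eqVlt => /orP[/eqP|lt_x]; first exact: wt_gt0.
rewrite wt_induced // mulr_gt0 ?invr_gt0 ?ltr0n ?reg_gt0 //.
have [|y xy] := @exists_cover x; first by rewrite ltn_eqF.
have pos z : covers x z -> 0 < wt P z.
  by move/(rk_covers P) => rz; apply: IHn; lia.
rewrite (bigD1 y) //= ltr_pwDl ?pos // sumr_ge0 // => z /andP[xz _].
exact/ltW/pos.
Qed.

Lemma sum_covers_gt0 (x : X) :
  (rk P x < pdim P)%N -> 0 < \sum_(y | covers x y) wt P y.
Proof.
move=> lt_x; have := weight_gt0 (ltnW lt_x).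
by rewrite wt_induced // pmulr_rgt0 // invr_gt0 ltr0n reg_gt0.
Qed.

(** Both sides run over the covering pairs between ranks [i] and [i.+1]; adjointness and contraction
    of [Uop] rest on this. *)
Lemma exchange_covers (i : nat) (F : X -> X -> R) :
  \sum_(y | rk P y == i.+1) \sum_(x | covers x y) F x y =
  \sum_(x | rk P x == i) \sum_(y | covers x y) F x y.
Proof.
rewrite (exchange_big_dep (fun x => rk P x == i)) /=; last first.
  by move=> y x /eqP ry /(rk_covers P); rewrite ry => -[->].
apply: eq_bigr => x /eqP rx; apply: eq_bigl => y.
by case xy: (covers x y); rewrite ?andbF // (rk_covers P xy) rx eqxx.
Qed.

(** Reading the values in the regular module [R^o] makes the functions a module over [R]. *)
Lemma Uop_is_linear (i : nat) :
  linear (Uop P i : {ffun X -> R^o} -> {ffun X -> R^o}).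
Proof.
move=> a f g; apply/ffunP => y; rewrite !ffunE.
case: ifP => _; last by rewrite scaler0 addr0.
rewrite -[X in _ = X + _]/(a * _) mulrCA -mulrDr; congr (_ * _).
by rewrite mulr_sumr -big_split; apply: eq_bigr => x _; rewrite !ffunE.
Qed.

Lemma Dop_is_linear (i : nat) :
  linear (Dop P i : {ffun X -> R^o} -> {ffun X -> R^o}).
Proof.
move=> a f g; apply/ffunP => y; rewrite !ffunE.
case: ifP => _; last by rewrite scaler0 addr0.
rewrite -[X in _ = X + _]/(a * _) mulrCA -mulrDr; congr (_ * _).
rewrite mulr_sumr -big_split; apply: eq_bigr => x _; rewrite !ffunE /=.
by rewrite mulrDr mulrCA.
Qed.

Lemma Upow_id (k : nat) (f : {ffun X -> R}) : Upow P k k f = f.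
Proof. by rewrite /Upow subnn. Qed.

Lemma Dpow_id (k : nat) (f : {ffun X -> R}) : Dpow P k k f = f.
Proof. by rewrite /Dpow subnn. Qed.

Lemma UpowS (k l : nat) (f : {ffun X -> R}) : (l <= k)%N ->
  Upow P k.+1 l f = Uop P k (Upow P k l f).
Proof.
move=> le_lk; rewrite /Upow subSn // -(addn1 (k - l)) iotaD foldl_cat /=.
by rewrite subnKC.
Qed.

Lemma DpowS (k l : nat) (f : {ffun X -> R}) : (l <= k)%N ->
  Dpow P k.+1 l f = Dpow P k l (Dop P k.+1 f).
Proof.
move=> le_lk; rewrite /Dpow subSn // -(addn1 (k - l)) iotaD foldr_cat /=.
by rewrite addSn subnKC.
Qed.

Lemma Dpow_comp (k m l : nat) (f : {ffun X -> R}) : (l <= m <= k)%N ->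
  Dpow P k l f = Dpow P m l (Dpow P k m f).
Proof.
move=> /andP[lm mk]; rewrite /Dpow -foldr_cat.
have -> : iota m.+1 (k - m) = iota (l.+1 + (m - l)) (k - m) by congr iota; lia.
by rewrite -iotaD; congr (foldr _ _ (iota _ _)); lia.
Qed.

Lemma Upow_comp (k m l : nat) (f : {ffun X -> R}) : (l <= m <= k)%N ->
  Upow P k l f = Upow P k m (Upow P m l f).
Proof.
move=> /andP[lm mk]; rewrite /Upow -foldl_cat.
have -> : iota m (k - m) = iota (l + (m - l)) (k - m) by congr iota; lia.
by rewrite -iotaD; congr (foldl _ _ (iota _ _)); lia.
Qed.

Lemma Upow_is_linear (k l : nat) :
  linear (Upow P k l : {ffun X -> R^o} -> {ffun X -> R^o}).
Proof.
move=> a f g; rewrite /Upow.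
by elim: (iota _ _) f g => //= m s IHs f g; rewrite Uop_is_linear IHs.
Qed.

Lemma Dpow_is_linear (k l : nat) :
  linear (Dpow P k l : {ffun X -> R^o} -> {ffun X -> R^o}).
Proof.
move=> a f g; rewrite /Dpow.
by elim: (iota _ _) f g => //= m s IHs f g; rewrite IHs Dop_is_linear.
Qed.

End Poset.

(** The sum of the squares [(n * a i - S) ^+ 2] is [n] times the difference of the two sides. *)
Lemma sqr_sum_le (R : realFieldType) (I : finType) (A : pred I) (a : I -> R) :
  (\sum_(i | A i) a i) ^+ 2 <= #|A|%:R * \sum_(i | A i) a i ^+ 2.
Proof.
have [A0|A_gt0] := posnP #|A|.
  rewrite !big_pred0 ?expr0n ?mulr0 // => i; exact: (card0_eq A0).
set S := \sum_(i | A i) a i; set n : R := #|A|%:R.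
have n_gt0 : 0 < n by rewrite ltr0n.
have : 0 <= \sum_(i | A i) (n * a i - S) ^+ 2 by apply: sumr_ge0 => i _; exact: sqr_ge0.
have -> : \sum_(i | A i) (n * a i - S) ^+ 2 =
    n ^+ 2 * (\sum_(i | A i) a i ^+ 2) - 2 * n * S * S + n * S ^+ 2.
  rewrite (_ : n * S ^+ 2 = \sum_(i | A i) S ^+ 2); last first.
    by rewrite sumr_const mulr_natl.
  rewrite (_ : 2 * n * S * S = \sum_(i | A i) 2 * n * S * a i); last first.
    by rewrite -mulr_sumr.
  rewrite mulr_sumr -sumrB -big_split /=.
  by apply: eq_bigr => i _; ring.
rewrite (_ : _ + _ = n * (n * (\sum_(i | A i) a i ^+ 2) - S ^+ 2)); last by ring.
by rewrite pmulr_rge0 // subr_ge0.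
Qed.

(** * Consequences of linearity *)

Section Linear.
Context (R : pzRingType) (U V : lmodType R) (F : U -> V) (F_lin : linear F).

Lemma linear_zero : F 0 = 0.
Proof.
by have := F_lin (-1) 0 0; rewrite scaler0 addr0 scaleN1r addNr.
Qed.

Lemma linear_scale (a : R) (u : U) : F (a *: u) = a *: F u.
Proof. by rewrite -[a *: u]addr0 F_lin linear_zero addr0. Qed.

Lemma linear_add (u v : U) : F (u + v) = F u + F v.
Proof. by rewrite -[u]scale1r F_lin !scale1r. Qed.

Lemma linear_sub (u v : U) : F (u - v) = F u - F v.
Proof. by rewrite linear_add -scaleN1r linear_scale scaleN1r. Qed.

Lemma linear_bigsum (I : Type) (s : seq I) (A : pred I) (u : I -> U) :
  F (\sum_(i <- s | A i) u i) = \sum_(i <- s | A i) F (u i).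
Proof.
elim/big_rec2: _ => [|i _ v _ <-]; first exact: linear_zero.
exact: linear_add.
Qed.

End Linear.

(** * Adjointness and contraction *)

Section InnerProduct.
Context (R : realType) (disp : Order.disp_t) (X : finPOrderType disp)
  (P : regular_poset R X).
Local Notation V := {ffun X -> R^o}.
Implicit Types (f g h : V) (i k l m : nat) (a b : R).

Lemma ipC k f g : ip P k f g = ip P k g f.
Proof. by apply: eq_bigr => x _; rewrite mulrAC. Qed.

Lemma ipDl k f g h : ip P k (f + g) h = ip P k f h + ip P k g h.
Proof. by rewrite -big_split; apply: eq_bigr => x _ /=; rewrite !ffunE; ring. Qed.

Lemma ipZl k a f h : ip P k (a *: f) h = a * ip P k f h.
Proof.
rewrite mulr_sumr; apply: eq_bigr => x _; rewrite !ffunE.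
rewrite -[a *: _]/(a * _); ring.
Qed.

Lemma ipNl k f h : ip P k (- f) h = - ip P k f h.
Proof. by rewrite -scaleN1r ipZl mulN1r. Qed.

Lemma ipBl k f g h : ip P k (f - g) h = ip P k f h - ip P k g h.
Proof. by rewrite ipDl ipNl. Qed.

Lemma ip0l k h : ip P k (0 : V) h = 0.
Proof. by rewrite -(scale0r (0 : V)) ipZl mul0r. Qed.

Lemma ip_suml (I : Type) (s : seq I) (A : pred I) k (F : I -> V) h :
  ip P k (\sum_(i <- s | A i) F i) h = \sum_(i <- s | A i) ip P k (F i) h.
Proof.
elim/big_rec2: _ => [|i _ f _ <-]; first exact: ip0l.
by rewrite ipDl.
Qed.

Lemma ipDr k f g h : ip P k h (f + g) = ip P k h f + ip P k h g.
Proof. by rewrite ipC ipDl !(ipC _ h). Qed.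

Lemma ipBr k f g h : ip P k h (f - g) = ip P k h f - ip P k h g.
Proof. by rewrite ipC ipBl !(ipC _ h). Qed.

Lemma ipZr k a f h : ip P k h (a *: f) = a * ip P k h f.
Proof. by rewrite ipC ipZl (ipC _ h). Qed.

Lemma ip0r k h : ip P k h (0 : V) = 0.
Proof. by rewrite ipC ip0l. Qed.

Lemma ip_sumr (I : Type) (s : seq I) (A : pred I) k (F : I -> V) h :
  ip P k h (\sum_(i <- s | A i) F i) = \sum_(i <- s | A i) ip P k h (F i).
Proof. by rewrite ipC ip_suml; apply: eq_bigr => i _; rewrite ipC. Qed.

Lemma ip_ge0 k f : (k <= pdim P)%N -> 0 <= ip P k f f.
Proof.
move=> le_k; apply: sumr_ge0 => x /eqP rx; rewrite -mulrA mulr_ge0 //.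
  by rewrite ltW // weight_gt0 // rx.
by rewrite -expr2 sqr_ge0.
Qed.

Lemma nrm_ge0 k f : 0 <= nrm P k f. Proof. exact: sqrtr_ge0. Qed.

Lemma sqr_nrm k f : (k <= pdim P)%N -> nrm P k f ^+ 2 = ip P k f f.
Proof. by move=> le_k; rewrite sqr_sqrtr // ip_ge0. Qed.

Lemma cauchy_schwarz k f g : (k <= pdim P)%N ->
  `|ip P k f g| <= nrm P k f * nrm P k g.
Proof.
move=> le_k; rewrite /nrm -sqrtrM ?ip_ge0 // -sqrtr_sqr ler_wsqrtr //.
have pos a b : 0 <= a ^+ 2 * ip P k f f + 2 * a * b * ip P k f g + b ^+ 2 * ip P k g g.
  have := ip_ge0 (a *: f + b *: g) le_k.
  rewrite ipDl !ipDr !ipZl !ipZr (ipC _ g f).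
  by congr (0 <= _); ring.
move: pos (ip_ge0 f le_k) (ip_ge0 g le_k).
set A := ip P k f f; set B := ip P k f g; set C := ip P k g g => pos A_ge0 C_ge0.
have [C_gt0|C_le0] := ltP 0 C.
  have := pos C (- B).
  rewrite (_ : _ + _ = C * (A * C - B ^+ 2)); last by ring.
  by rewrite pmulr_rge0 // subr_ge0.
have [A_gt0|A_le0] := ltP 0 A.
  have := pos (- B) A.
  rewrite (_ : _ + _ = A * (A * C - B ^+ 2)); last by ring.
  by rewrite pmulr_rge0 // subr_ge0.
(* Both [A] and [C] vanish here, so the form is [2 * a * b * B], and the two sign choices force
   [B = 0]. *)
have := pos 1 1; have := pos 1 (-1); nra.
Qed.

Lemma nrmD k f g : (k <= pdim P)%N -> nrm P k (f + g) <= nrm P k f + nrm P k g.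
Proof.
move=> le_k; rewrite -(ler_pXn2r (_ : 0 < 2)%N) ?nnegrE ?addr_ge0 ?nrm_ge0 //.
rewrite sqrrD !sqr_nrm // ipDl !ipDr (ipC _ g f).
have := le_trans (ler_norm _) (cauchy_schwarz f g le_k); lra.
Qed.

Lemma nrmZ k a f : nrm P k (a *: f) = `|a| * nrm P k f.
Proof. by rewrite /nrm ipZl ipZr mulrA -expr2 sqrtrM ?sqr_ge0 // sqrtr_sqr. Qed.

Lemma nrmN k f : nrm P k (- f) = nrm P k f.
Proof. by rewrite -scaleN1r nrmZ normrN normr1 mul1r. Qed.

Lemma nrm0 k : nrm P k (0 : V) = 0.
Proof. by rewrite /nrm ip0l sqrtr0. Qed.

Lemma nrmB k f g : (k <= pdim P)%N -> nrm P k (f - g) <= nrm P k f + nrm P k g.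
Proof. by move=> le_k; rewrite -(nrmN k g) nrmD. Qed.

Lemma UopB i f g : Uop P i (f - g) = (Uop P i f : V) - Uop P i g.
Proof. exact: (linear_sub (Uop_is_linear P i)). Qed.
Lemma UopZ i a f : Uop P i (a *: f) = a *: (Uop P i f : V).
Proof. exact: (linear_scale (Uop_is_linear P i)). Qed.

Lemma DopZ i a f : Dop P i (a *: f) = a *: (Dop P i f : V).
Proof. exact: (linear_scale (Dop_is_linear P i)). Qed.

Lemma UpowZ k l a f : Upow P k l (a *: f) = a *: (Upow P k l f : V).
Proof. exact: (linear_scale (Upow_is_linear P k l)). Qed.

Lemma DpowD k l f g : Dpow P k l (f + g) = (Dpow P k l f : V) + Dpow P k l g.
Proof. exact: (linear_add (Dpow_is_linear P k l)). Qed.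
Lemma DpowB k l f g : Dpow P k l (f - g) = (Dpow P k l f : V) - Dpow P k l g.
Proof. exact: (linear_sub (Dpow_is_linear P k l)). Qed.
Lemma DpowZ k l a f : Dpow P k l (a *: f) = a *: (Dpow P k l f : V).
Proof. exact: (linear_scale (Dpow_is_linear P k l)). Qed.

(** By [wt_induced] the normalising sum in [Dop] is [reg P i.+1 i] times [wt P x], so both sides
    weigh each covering pair equally. *)
Lemma Uop_adjoint i f g : (i < pdim P)%N ->
  ip P i.+1 (Uop P i f) g = ip P i f (Dop P i.+1 g).
Proof.
move=> lt_i; rewrite /ip.
transitivity (\sum_(y | rk P y == i.+1) \sum_(x | covers x y)
    (reg P i.+1 i)%:R^-1 * f x * (wt P y * g y)).
  apply: eq_bigr => y /eqP ry; rewrite ffunE ry eqxx -mulr_suml -mulr_sumr.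
  ring.
rewrite exchange_covers; apply: eq_bigr => x /eqP rx.
rewrite ffunE rx eqxx wt_induced ?rx // -mulr_sumr.
have := @sum_covers_gt0 _ _ _ P x; rewrite rx => /(_ lt_i)/gt_eqF/negbT s_neq0.
have r_neq0 : (reg P i.+1 i)%:R != 0 :> R by rewrite pnatr_eq0 -lt0n reg_gt0.
by field; rewrite s_neq0 r_neq0.
Qed.

(** The square of each average is at most the average of the squares; after exchanging the sums,
    [wt_induced] recombines the weights. *)
Lemma nrm_Uop i f : (i < pdim P)%N -> nrm P i.+1 (Uop P i f) <= nrm P i f.
Proof.
move=> lt_i; apply: ler_wsqrtr; rewrite /ip.
have r_gt0 : 0 < (reg P i.+1 i)%:R :> R by rewrite ltr0n reg_gt0.
apply: le_trans (_ : \sum_(y | rk P y == i.+1) \sum_(x | covers x y)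
    (reg P i.+1 i)%:R^-1 * wt P y * f x ^+ 2 <= _).
  apply: ler_sum => y /eqP ry; rewrite ffunE ry eqxx -mulr_sumr.
  have := sqr_sum_le (fun x => covers x y) f; rewrite (card_covers ry).
  set S := \sum_(x | _) _; set Q := \sum_(x | _) _; move=> le_S.
  rewrite -subr_ge0 (_ : _ - _ =
    wt P y * (reg P i.+1 i)%:R^-1 ^+ 2 * ((reg P i.+1 i)%:R * Q - S ^+ 2)).
    by rewrite mulr_ge0 ?subr_ge0 // mulr_ge0 ?sqr_ge0 // ltW ?weight_gt0 ?ry.
  by field; rewrite gt_eqF.
rewrite exchange_covers; apply: ler_sum => x /eqP rx.
rewrite wt_induced ?rx // -mulr_suml -mulr_sumr.
by rewrite expr2 !mulrA.
Qed.

(** By duality [|D f|^2 = <U D f, f>]; as [U] is a contraction, one factor [|D f|] cancels. *)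
Lemma nrm_Dop i f : (i < pdim P)%N -> nrm P i (Dop P i.+1 f) <= nrm P i.+1 f.
Proof.
move=> lt_i; have [->|n0] := eqVneq (nrm P i (Dop P i.+1 f)) 0.
  exact: nrm_ge0.
have n_gt0 : 0 < nrm P i (Dop P i.+1 f) by rewrite lt_def n0 nrm_ge0.
rewrite -(ler_pM2l n_gt0) -expr2 sqr_nrm ?(ltnW lt_i) // -Uop_adjoint //.
apply: le_trans (ler_norm _) (le_trans (cauchy_schwarz _ _ lt_i) _).
by rewrite ler_wpM2r ?nrm_ge0 ?nrm_Uop.
Qed.

Lemma nrm_Upow k l f : (l <= k <= pdim P)%N ->
  nrm P k (Upow P k l f) <= nrm P l f.
Proof.
elim: k => [|k IHk]; first by rewrite leqn0 => /andP[/eqP -> _]; rewrite Upow_id.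
case/andP; rewrite leq_eqVlt => /predU1P[->|lt_l] lt_k; first by rewrite Upow_id.
rewrite UpowS //; apply: le_trans (nrm_Uop _ lt_k) (IHk _).
by rewrite -ltnS lt_l ltnW.
Qed.

Lemma nrm_Dpow k l f : (l <= k <= pdim P)%N ->
  nrm P l (Dpow P k l f) <= nrm P k f.
Proof.
elim: k f => [|k IHk] f.
  by rewrite leqn0 => /andP[/eqP -> _]; rewrite Dpow_id.
case/andP; rewrite leq_eqVlt => /predU1P[->|lt_l] lt_k; first by rewrite Dpow_id.
rewrite DpowS //; apply: le_trans (nrm_Dop _ lt_k); apply: IHk.
by rewrite -ltnS lt_l ltnW.
Qed.

Lemma Upow_adjoint k l f g : (l <= k <= pdim P)%N ->
  ip P k (Upow P k l f) g = ip P l f (Dpow P k l g).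
Proof.
elim: k g => [|k IHk] g.
  by rewrite leqn0 => /andP[/eqP -> _]; rewrite Dpow_id Upow_id.
case/andP; rewrite leq_eqVlt => /predU1P[->|lt_l] lt_k.
  by rewrite Dpow_id Upow_id.
rewrite DpowS // UpowS // Uop_adjoint // IHk //.
by rewrite -ltnS lt_l ltnW.
Qed.

End InnerProduct.

(** * Dependence on a single rank, constant functions, operator norm *)

Section Local.
Context (R : realType) (disp : Order.disp_t) (X : finPOrderType disp)
  (P : regular_poset R X).
Local Notation V := {ffun X -> R^o}.
Implicit Types (f g h : V) (i k l m : nat) (a b : R).

Lemma Uop_ext i f g : (forall x, rk P x = i -> f x = g x) -> Uop P i f = Uop P i g.
Proof.
move=> fg; apply/ffunP => y; rewrite !ffunE; case: eqP => // ry; congr (_ * _).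
apply: eq_bigr => x /(rk_covers P); rewrite ry => -[rx]; exact: fg.
Qed.

Lemma Dop_ext i f g : (forall x, rk P x = i -> f x = g x) -> Dop P i f = Dop P i g.
Proof.
move=> fg; apply/ffunP => x; rewrite !ffunE; case: eqP => // rx; congr (_ * _).
apply: eq_bigr => y /(rk_covers P); rewrite rx => ry; congr (_ * _); exact: fg.
Qed.

Lemma nrm_ext i f g : (forall x, rk P x = i -> f x = g x) -> nrm P i f = nrm P i g.
Proof.
move=> fg; congr Num.sqrt; apply: eq_bigr => x /eqP rx.
by rewrite (fg _ rx).
Qed.

Definition level_one k : V := [ffun x => (rk P x == k)%:R].

Lemma level_oneE k x : level_one k x = (rk P x == k)%:R.
Proof. exact: ffunE. Qed.

Lemma Uop_level_one i : (i < pdim P)%N -> Uop P i (level_one i) = level_one i.+1.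
Proof.
move=> lt_i; apply/ffunP => y; rewrite !ffunE; case: eqP => // ry.
rewrite (eq_bigr (fun=> 1)) => [|x /(rk_covers P)]; last first.
  by rewrite ry level_oneE => -[->]; rewrite eqxx.
by rewrite sumr_const (card_covers ry) mulVf // pnatr_eq0 -lt0n reg_gt0.
Qed.

Lemma Dop_level_one i : (i < pdim P)%N -> Dop P i.+1 (level_one i.+1) = level_one i.
Proof.
move=> lt_i; apply/ffunP => x; rewrite !ffunE eqSS; case: eqP => // rx.
rewrite [X in _ * X](eq_bigr (wt P)) => [|y /(rk_covers P)]; last first.
  by rewrite rx level_oneE => ->; rewrite eqxx mulr1.
by rewrite mulVf // gt_eqF // sum_covers_gt0 ?rx.
Qed.

Lemma Upow_level_one k l : (l <= k <= pdim P)%N ->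
  Upow P k l (level_one l) = level_one k.
Proof.
elim: k => [|k IHk]; first by rewrite leqn0 => /andP[/eqP -> _]; rewrite Upow_id.
case/andP; rewrite leq_eqVlt => /predU1P[->|lt_l] lt_k; first by rewrite Upow_id.
by rewrite UpowS // IHk ?Uop_level_one // -ltnS lt_l ltnW.
Qed.

Lemma Dpow_level_one k l : (l <= k <= pdim P)%N ->
  Dpow P k l (level_one k) = level_one l.
Proof.
elim: k => [|k IHk]; first by rewrite leqn0 => /andP[/eqP -> _]; rewrite Dpow_id.
case/andP; rewrite leq_eqVlt => /predU1P[->|lt_l] lt_k; first by rewrite Dpow_id.
by rewrite DpowS // Dop_level_one // IHk // -ltnS lt_l ltnW.
Qed.

Lemma rank0_unique (x y : X) : rk P x = 0%N -> rk P y = 0%N -> x = y.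
Proof.
move=> rx ry; have /card_le1_eqP := eq_leq (card_rk0 P).
by apply; rewrite inE ?rx ?ry.
Qed.

(** There is a single face of rank 0. *)
Lemma rank0_constant f : exists a, forall x, rk P x = 0%N -> f x = (a *: level_one 0%N) x.
Proof.
have [e re] := exists_rk (leq0n (pdim P)).
exists (f e) => x rx; rewrite !ffunE rx eqxx (rank0_unique rx re).
by rewrite -[_ *: _]/(_ * _) mulr1.
Qed.

(** A [sup] is known to bound its set only when that set is bounded above, hence the crude bound
    [M]; the rest is scaling [f] to norm 1. *)
Lemma opnorm_bound i (A : V -> V) (M : R) : linear A ->
  (forall g, nrm P i (A g) <= M * nrm P i g) ->
  forall f, Ck P i f -> nrm P i (A f) <= opnorm P i A * nrm P i f.
Proof.
move=> linA bA f Cf; have [n0|n0] := eqVneq (nrm P i f) 0.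
  by rewrite n0 mulr0; have := bA f; rewrite n0 mulr0.
have n_gt0 : 0 < nrm P i f by rewrite lt_def n0 nrm_ge0.
rewrite -ler_pdivrMr // mulrC.
have -> : (nrm P i f)^-1 * nrm P i (A f) = nrm P i (A ((nrm P i f)^-1 *: f)).
  by rewrite linear_scale // nrmZ ger0_norm // invr_ge0 nrm_ge0.
have C1 : Ck P i ((nrm P i f)^-1 *: f).
  by move=> x rx; rewrite ffunE Cf // scaler0.
have n1 : nrm P i ((nrm P i f)^-1 *: f) <= 1.
  by rewrite nrmZ ger0_norm ?invr_ge0 ?nrm_ge0 // mulVf.
apply: ub_le_sup; last by exists ((nrm P i f)^-1 *: f).
exists `|M| => _ [g [_ g1 ->]]; apply: le_trans (bA g) _.
apply: le_trans (_ : `|M| * nrm P i g <= _).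
  by rewrite ler_wpM2r ?nrm_ge0 // ler_norm.
by rewrite ler_piMr.
Qed.

End Local.

Lemma scaleoE (R : pzRingType) (a : R) (b : R^o) : a *: b = a * b.
Proof. by []. Qed.

(** * Walks in an eposet *)

Section Eposet.
Context (R : realType) (disp : Order.disp_t) (X : finPOrderType disp)
  (P : regular_poset R X) (delta : nat -> R) (gamma : R).
Hypotheses (ep : eposet P delta gamma) (gamma_ge0 : 0 <= gamma).
Local Notation V := {ffun X -> R^o}.
Implicit Types (f g h : V) (i k l m : nat) (a b : R).

Lemma delta_bounds i : (i < pdim P)%N -> 0 <= delta i <= 1.
Proof.
case: ep => d0 d1 _; case: i => [|i] lt_i; first by rewrite d0 lexx ler01.
exact: d1.
Qed.

(* The seminorms [nrm P i] and the operators only see the values at the relevant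
   rank, so this and all later estimates hold for functions outside [Ck] too. *)
Lemma eposet_step i f : (i < pdim P)%N ->
  nrm P i ((Dop P i.+1 (Uop P i f) : V) - (1 - delta i) *: f
           - delta i *: (Uop P i.-1 (Dop P i f) : V)) <= gamma * nrm P i f.
Proof.
case: i => [|i] lt_i.
  (* At rank 0, [f] is a constant, which [D_1 U_0] fixes, and [delta 0 = 0] removes the last
     term. *)
  have [a fE] := rank0_constant P f; case: ep => -> _ _.
  rewrite subr0 scale1r scale0r subr0 (Uop_ext fE) UopZ DopZ.
  rewrite Uop_level_one // Dop_level_one //.
  rewrite (@nrm_ext _ _ _ P _ _ 0) ?nrm0 ?mulr_ge0 ?nrm_ge0 // => x rx.
  by move: (_ *: _) fE => g fE; rewrite !ffunE fE // subrr.
case: (ep) => _ _ /(_ i.+1 lt_i).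
set A := fun f => _; pose A' f := (Dop P i.+2 (Uop P i.+1 f) : V)
   - (1 - delta i.+1) *: f - delta i.+1 *: (Uop P i (Dop P i.+1 f) : V).
have AE g : A g = A' g.
  apply/ffunP => x; rewrite /A' ffunE /=.
  move: (Dop _ _ _) (Uop _ _ _) => q r.
  by rewrite !ffunE.
move=> opA; rewrite -/(A' f).
(* The operator norm tests only functions supported on rank [i.+1], so [f] is replaced by its
   restriction. *)
pose f' : V := [ffun x => if rk P x == i.+1 then f x else 0].
have ff' x : rk P x = i.+1 -> f x = f' x by move=> rx; rewrite ffunE rx eqxx.
rewrite (nrm_ext ff') (_ : nrm P i.+1 (A' f) = nrm P i.+1 (A f')); last first.
  rewrite AE; apply: nrm_ext => x rx; rewrite /A' (Uop_ext ff') (Dop_ext ff').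
  by do 2![rewrite [LHS]ffunE [RHS]ffunE; congr (_ + _)]; rewrite !ffunE rx eqxx.
have /andP[d0 d1] := delta_bounds lt_i.
have le_i := ltnW lt_i.
apply: le_trans (_ : opnorm P i.+1 A * nrm P i.+1 f' <= _); last first.
  by rewrite ler_wpM2r ?nrm_ge0.
(* The crude bound is 2: [D U] is a contraction, and so is the convex combination of the identity
   and [U D]. *)
apply: (@opnorm_bound _ _ _ P _ A 2).
- move=> a u v; rewrite !AE /A' !(Uop_is_linear, Dop_is_linear).
  apply/ffunP => x; rewrite !(scalerDr, scalerA).
  move: (Dop _ _ _) (Dop _ _ _) (Uop _ _ _) (Uop _ _ _) => q r s t.
  rewrite !ffunE !scaleoE; ring.
- move=> g; rewrite AE; apply: le_trans (nrmB _ _ le_i) _.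
  have := nrmB (Dop P i.+2 (Uop P i.+1 g)) ((1 - delta i.+1) *: g) le_i.
  rewrite !nrmZ !ger0_norm ?subr_ge0 //.
  have := le_trans (nrm_Dop (Uop P i.+1 g) lt_i) (nrm_Uop g lt_i).
  have := le_trans (nrm_Uop (Dop P i.+1 g) le_i) (nrm_Dop g le_i).
  move: (nrm P i.+1 (_ - _)) (nrm _ _ _) (nrm _ _ (Uop _ _ _)) => u v w.
  by move: (nrm P i.+1 g) => n; nra.
- by move=> x /eqP/negbTE rx; rewrite ffunE rx.
Qed.

End Eposet.

(** * Iterating the one-step relation along a chain of levels *)

Section Walk.
Context (R : realType) (disp : Order.disp_t) (X : finPOrderType disp)
  (P : regular_poset R X) (delta : nat -> R) (gamma : R).
Hypotheses (ep : eposet P delta gamma) (gamma_ge0 : 0 <= gamma).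
Local Notation V := {ffun X -> R^o}.
Implicit Types (f g h : V) (i k l m : nat) (a b : R).

(** For [i <= m] this is [delta^m_(m-i)], indexed by its two ends. *)
Definition delta_run i m : R := \prod_(i <= s < m.+1) delta s.

(** The factor by which [D^k_l] approximately takes [U^k_i g] to [U^l_i g] for [g] in [Ker D_i];
    when [i <= l] it equals [lambda_lower delta k l i]. *)
Definition walk_rate i l k : R := \prod_(l <= m < k) (1 - delta_run i m).

Lemma delta_run_bounds i m : (m < pdim P)%N -> 0 <= delta_run i m <= 1.
Proof.
move=> lt_m; rewrite /delta_run big_nat_cond; apply/andP; split.
  apply: prodr_ge0 => s /andP[/andP[_ le_s] _].
  by case/andP: (delta_bounds ep (leq_ltn_trans (le_s : (s <= m)%N) lt_m)).
apply: prodr_ile1 => s /andP[/andP[_ le_s] _].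
exact: (delta_bounds ep (leq_ltn_trans (le_s : (s <= m)%N) lt_m)).
Qed.

Lemma delta_runS i m : (i <= m.+1)%N ->
  delta_run i m.+1 = delta_run i m * delta m.+1.
Proof. by move=> le_im; rewrite /delta_run big_nat_recr. Qed.

Lemma walk_rateS i l k : (l <= k)%N ->
  walk_rate i l k.+1 = walk_rate i l k * (1 - delta_run i k).
Proof. by move=> le_lk; rewrite /walk_rate big_nat_recr. Qed.

Lemma walk_rate_bounds i l k : (k <= pdim P)%N -> 0 <= walk_rate i l k <= 1.
Proof.
move=> le_k; rewrite /walk_rate big_nat_cond; apply/andP; split.
  apply: prodr_ge0 => s /andP[/andP[_ lt_s] _].
  by case/andP: (delta_run_bounds i (leq_trans lt_s le_k)); lra.
apply: prodr_ile1 => s /andP[/andP[_ lt_s] _].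
by case/andP: (delta_run_bounds i (leq_trans lt_s le_k)); lra.
Qed.

(* For [i = 0] the last term vanishes, since [delta 0 = 0] and [Dop P 0] is the
   zero operator; so the junk value [0.-1 = 0] does no harm. *)
Definition step_error i m g : V :=
  (Dop P m.+1 (Upow P m.+1 i g) : V) - (1 - delta_run i m) *: (Upow P m i g : V)
  - delta_run i m *: (Upow P m i.-1 (Dop P i g) : V).

(** Applying the eposet relation to [U^(m+1)_i g] costs [gamma |g|], and its [U D] term reproduces
    the previous error, damped by [delta m.+1 <= 1] and a contraction. So each level adds one
    [gamma |g|]. *)
Lemma nrm_step_error i m g : (i <= m < pdim P)%N ->
  nrm P m (step_error i m g) <= (m - i).+1%:R * gamma * nrm P i g.
Proof.
elim: m => [|m IHm].
  rewrite leqn0 => /andP[/eqP -> lt_0]; rewrite subnn mul1r.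
  apply: le_trans (eposet_step ep gamma_ge0 g lt_0).
  rewrite /step_error /delta_run big_nat1 UpowS // !Upow_id.
  by case: ep => -> _ _; rewrite !scale0r.
case/andP; rewrite leq_eqVlt => /predU1P[->|lt_i] lt_m.
  rewrite subnn mul1r; apply: le_trans (eposet_step ep gamma_ge0 g lt_m).
  rewrite /step_error /delta_run big_nat1 (UpowS P g (leqnn m.+1)).
  by rewrite (UpowS P (Dop P m.+1 g) (leqnn m)) !Upow_id.
have le_m := ltnW lt_m.
pose h : V := Upow P m.+1 i g.
(* The coefficients of [h] match since [(1 - d) + d * (1 - r) = 1 - d * r] for [d = delta m.+1] and
   [r = delta_run i m]. *)
have -> : step_error i m.+1 g =
    ((Dop P m.+2 (Uop P m.+1 h) : V) - (1 - delta m.+1) *: h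
      - delta m.+1 *: (Uop P m (Dop P m.+1 h) : V))
    + delta m.+1 *: (Uop P m (step_error i m g) : V).
  rewrite {2}/step_error !UopB !UopZ /step_error -!UpowS; try lia.
  rewrite delta_runS ?(ltnW lt_i) // -/h.
  move: (Dop P m.+2 _) (Uop P m _) (Upow P m.+1 _ _) => q r s.
  by apply/ffunP => x; rewrite !ffunE !scaleoE; ring.
apply: le_trans (nrmD _ _ le_m) _.
have := eposet_step ep gamma_ge0 h lt_m; rewrite -/h.
have /andP[d0 d1] := delta_bounds ep lt_m.
have hg : nrm P m.+1 h <= nrm P i g by rewrite nrm_Upow // (ltnW lt_i).
have e0 := nrm_ge0 P m (step_error i m g).
have := le_trans (nrm_Uop (step_error i m g) le_m) (IHm _).
have -> : (i <= m < pdim P)%N by rewrite -ltnS lt_i.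
move=> /(_ isT); rewrite nrmZ ger0_norm // subSn // -(natr1 (m - i).+1).
move: (nrm _ _ (Uop P m _)) (nrm_ge0 P m.+1 (Uop P m (step_error i m g))).
move: (nrm P i g) (nrm P m.+1 h) hg => n u hg v v0 v_le s_le.
have : delta m.+1 * v <= v by rewrite ler_piMl.
have : gamma * u <= gamma * n by rewrite ler_wpM2l.
lra.
Qed.

Lemma step_decomposition i m g :
  Dop P m.+1 (Upow P m.+1 i g) = step_error i m g
    + (1 - delta_run i m) *: (Upow P m i g : V)
    + delta_run i m *: (Upow P m i.-1 (Dop P i g) : V) :> V.
Proof. by rewrite /step_error addrAC !subrK. Qed.

(** On the kernel the last term of [step_decomposition] vanishes, so each [D] multiplies by
    [1 - delta_run i m] up to a [step_error]. The later factors and operators do not amplify errors,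
    and there are [k - l] steps. *)
Lemma walk_on_kernel i l k g : (i <= l <= k)%N -> (k <= pdim P)%N ->
  Dop P i g = 0 :> V ->
  nrm P l ((Dpow P k l (Upow P k i g) : V) - walk_rate i l k *: (Upow P l i g : V))
    <= (k - l)%:R * k%:R * gamma * nrm P i g.
Proof.
move=> + + Dg0; elim: k => [|k IHk].
  case/andP => le_il; rewrite leqn0 => /eqP l0 _.
  by rewrite l0 Dpow_id /walk_rate big_geq // scale1r subrr nrm0 subnn !mul0r.
case/andP=> le_il; rewrite leq_eqVlt => /predU1P[<-|lt_l] lt_k.
  by rewrite Dpow_id /walk_rate big_geq // scale1r subrr nrm0 subnn !mul0r.
have le_lk : (l <= k)%N by [].
have le_k := ltnW lt_k.
rewrite DpowS // step_decomposition Dg0.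
rewrite (linear_zero (Upow_is_linear _ _ _)) scaler0 addr0 DpowD DpowZ walk_rateS //.
rewrite [walk_rate _ _ _ * _]mulrC -scalerA -addrA -scalerBr.
apply: le_trans (nrmD _ _ (leq_trans le_lk le_k)) _.
have /andP[r0 r1] := delta_run_bounds i lt_k.
rewrite nrmZ ger0_norm ?subr_ge0 //.
have le_lkd : (l <= k <= pdim P)%N by rewrite le_lk.
have := nrm_Dpow (step_error i k g) le_lkd.
have le_ikd : (i <= k < pdim P)%N by rewrite (leq_trans le_il).
move=> /le_trans /(_ (nrm_step_error g le_ikd)).
have le_ilk : (i <= l <= k)%N by rewrite le_il.
have := IHk le_ilk le_k.
set u := nrm P l (_ - _); set v := nrm P l _.
have : 0 <= u := nrm_ge0 _ _ _.
move: u v => u v u0 le_u le_v.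
have t0 : 0 <= gamma * nrm P i g by rewrite mulr_ge0 ?nrm_ge0.
have : (1 - delta_run i k) * u <= u by rewrite ler_piMl //; lra.
have : ((k - i).+1%:R : R) <= k.+1%:R by rewrite ler_nat; lia.
have : ((k - l)%:R : R) * k%:R <= (k - l)%:R * k.+1%:R.
  by rewrite ler_wpM2l // ler_nat.
rewrite subSn // -(natr1 (k - l)); move: le_u le_v t0.
rewrite -!(mulrA _ gamma); move: (gamma * _) => t.
move: (k - l)%:R (k - i).+1%:R (k.+1%:R) (k%:R) => p q s r.
nra.
Qed.

(** Stopping at rank [i] gives a multiple of [g] plus an error; the next [D] kills [g], so only the
    error survives. *)
Lemma walk_below_kernel i l k g : (l < i <= k)%N -> (k <= pdim P)%N ->
  Dop P i g = 0 :> V ->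
  nrm P l (Dpow P k l (Upow P k i g)) <= k%:R ^+ 2 * gamma * nrm P i g.
Proof.
move=> /andP[lt_li le_ik] le_k Dg0.
have le_i := leq_trans le_ik le_k.
have le_iik : (i <= i <= k)%N by rewrite leqnn.
have := walk_on_kernel le_iik le_k Dg0; rewrite Upow_id.
set h : V := Dpow P k i _; move=> le_h.
have -> : Dpow P k l (Upow P k i g) = Dpow P i l (h - walk_rate i i k *: g).
  rewrite (Dpow_comp P _ (m := i)) ?(ltnW lt_li) // -/h DpowB DpowZ.
  have -> : Dpow P i l g = 0 :> V.
    case: i lt_li Dg0 {le_ik le_i le_iik h le_h} => // i lt_li Dg0.
    by rewrite DpowS // Dg0 (linear_zero (Dpow_is_linear _ _ _)).
  by rewrite scaler0 subr0.
apply: le_trans (nrm_Dpow _ _) (le_trans le_h _); first by rewrite (ltnW lt_li).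
rewrite expr2 !ler_wpM2r ?nrm_ge0 // ler_nat; lia.
Qed.

(** A version of the previous bound for [g] that is only nearly in the kernel, such as an indicator.
    Each step is a convex combination of the previous walk and one started from [D_i g], plus a
    [step_error]. *)
Lemma walk_stays_in_kernel i m g : (0 < i <= m)%N -> (m <= pdim P)%N ->
  nrm P i.-1 (Dpow P m i.-1 (Upow P m i g))
    <= nrm P i.-1 (Dop P i g) + (m - i)%:R * m%:R * gamma * nrm P i g.
Proof.
elim: m => [|m IHm]; first by lia.
case/andP=> i_gt0; rewrite leq_eqVlt => /predU1P[im|lt_i] lt_m.
  rewrite im subnn !mul0r addr0 Upow_id /= DpowS // Dpow_id //.
have le_im : (i <= m)%N by [].
have le_m := ltnW lt_m.
have le_imd : (i <= m < pdim P)%N by rewrite le_im.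
have le_predi : (i.-1 <= m <= pdim P)%N by rewrite le_m andbT; lia.
have le_predi' : (i.-1 <= pdim P)%N by lia.
rewrite DpowS; last by lia.
rewrite step_decomposition 2!DpowD 2!DpowZ.
apply: le_trans (nrmD _ _ le_predi') _.
have /andP[r0 r1] := delta_run_bounds i lt_m.
apply: le_trans (lerD (nrmD _ _ le_predi') (lexx _)) _.
rewrite !nrmZ !ger0_norm ?subr_ge0 //.
have := le_trans (nrm_Dpow (step_error i m g) le_predi) (nrm_step_error g le_imd).
have := le_trans (nrm_Dpow (Upow P m i.-1 (Dop P i g)) le_predi) (nrm_Upow _ le_predi).
have i0m : (0 < i <= m)%N by rewrite i_gt0.
have := IHm i0m le_m.
set u := nrm P i.-1 (Dpow P m i.-1 (Upow P m i g)).
set v := nrm P i.-1 (Dpow P m i.-1 (Upow P m i.-1 _)).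
set e := nrm P i.-1 (Dpow P m i.-1 _).
rewrite -(natr1 (m - i)) subSn // -(natr1 (m - i)) -(natr1 m).
have t0 : 0 <= gamma * nrm P i g by rewrite mulr_ge0 ?nrm_ge0.
rewrite -!(mulrA _ gamma); move: (gamma * _) t0 => t t0.
move: (nrm P i.-1 _) (delta_run i m) r0 r1 => b r r0 r1 le_u le_v le_e.
have p0 : 0 <= (m - i)%:R * m%:R * t by rewrite !mulr_ge0.
have m0 : 0 <= m%:R * t by rewrite mulr_ge0.
move: ((m - i)%:R) (m%:R) le_u le_e p0 m0 => p q le_u le_e p0 m0.
have : (1 - r) * u <= (1 - r) * (b + p * q * t) by rewrite ler_wpM2l ?subr_ge0.
have : r * v <= r * b by rewrite ler_wpM2l.
have : 0 <= r * (p * q * t) by rewrite mulr_ge0.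
lra.
Qed.

(* The cross term is at most [B = |D_i g|^2 + k^2 gamma |g|^2], so each step is a
   convex combination of the previous value and [B], up to [k gamma |g|^2]. *)
Lemma sqr_nrm_Upow_le i k m g : (0 < i <= m)%N -> (m <= k <= pdim P)%N ->
  nrm P m (Upow P m i g) ^+ 2
    <= walk_rate i i m * nrm P i g ^+ 2
       + (1 - walk_rate i i m)
         * (nrm P i.-1 (Dop P i g) ^+ 2 + k%:R ^+ 2 * gamma * nrm P i g ^+ 2)
       + (m - i)%:R * k%:R * gamma * nrm P i g ^+ 2.
Proof.
elim: m => [|m IHm]; first by lia.
case/andP=> i_gt0; rewrite leq_eqVlt => /predU1P[im|lt_i] /andP[lt_mk le_k].
  by rewrite im subnn /walk_rate big_geq // Upow_id; lra.
have le_im : (i <= m)%N by [].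
have lt_m := leq_trans lt_mk le_k; have le_m := ltnW lt_m.
have le_imd : (i <= m < pdim P)%N by rewrite le_im.
have le_imd' : (i <= m <= pdim P)%N by rewrite le_im.
have le_predi : (i.-1 <= m <= pdim P)%N by rewrite le_m andbT; lia.
have i0m : (0 < i <= m)%N by rewrite i_gt0.
have le_mkd : (m <= k <= pdim P)%N by rewrite le_k andbT ltnW.
have := IHm i0m le_mkd; set h : V := Upow P m i g.
(* One [U] moves across as a [D], which is then decomposed; the cross term is brought down to rank
   [i.-1] by adjointness. *)
have -> : nrm P m.+1 (Upow P m.+1 i g) ^+ 2 =
    ip P m h (step_error i m g) + (1 - delta_run i m) * nrm P m h ^+ 2
    + delta_run i m * ip P i.-1 (Dop P i g) (Dpow P m i.-1 h).
  rewrite sqr_nrm // {1}UpowS // Uop_adjoint // step_decomposition -/h !ipDr !ipZr.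
  by rewrite sqr_nrm // (ipC _ m h (Upow _ _ _ _)) Upow_adjoint.
have /andP[r0 r1] := delta_run_bounds i lt_m.
have le_predi' : (i.-1 <= pdim P)%N by lia.
have := le_trans (ler_norm _) (cauchy_schwarz (Dop P i g) (Dpow P m i.-1 h) le_predi').
have := le_trans (ler_norm _) (cauchy_schwarz h (step_error i m g) le_m).
have := nrm_step_error g le_imd.
have := walk_stays_in_kernel g i0m le_m; rewrite -/h.
have := nrm_Upow g le_imd'; rewrite -/h.
have bn : nrm P i.-1 (Dop P i g) <= nrm P i g.
  case: (i) i_gt0 le_imd' => // i' _ /andP[a b]; apply: nrm_Dop; lia.
have := nrm_ge0 P i.-1 (Dop P i g); have := nrm_ge0 P m h; move: bn.
rewrite walk_rateS // subSn // -(natr1 (m - i)).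
move: (nrm P i.-1 (Dpow _ _ _ _)) (nrm _ _ (step_error _ _ _)) (nrm P m h) => u e v.
move: (nrm P i.-1 _) (nrm P i g) => b n bn v0 b0 vn le_u le_e.
move: (ip P i.-1 _ _) (ip P m _ _) => B A le_A le_B.
have n0 : 0 <= n := le_trans b0 bn.
have g_n2 : 0 <= gamma * n ^+ 2 by rewrite mulr_ge0 ?sqr_ge0.
have le_An : A <= k%:R * gamma * n ^+ 2.
  have le_q : (m - i)%:R + 1 <= k%:R :> R.
    by rewrite natr1 ler_nat (leq_ltn_trans (leq_subr _ _) lt_mk).
  apply: le_trans le_A (le_trans (ler_wpM2l v0 le_e) _).
  have -> : k%:R * gamma * n ^+ 2 = n * (k%:R * gamma * n) by ring.
  by apply: ler_pM; rewrite ?mulr_ge0 ?addr_ge0 // !ler_wpM2r.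
have le_Bn : B <= b ^+ 2 + k%:R ^+ 2 * gamma * n ^+ 2.
  have le_q : (m - i)%:R * m%:R <= k%:R ^+ 2 :> R.
    rewrite -natrM -natrX ler_nat -mulnn leq_mul // ?(ltnW lt_mk) //.
    exact: leq_trans (leq_subr _ _) (ltnW lt_mk).
  apply: le_trans le_B (le_trans (ler_wpM2l b0 le_u) _).
  rewrite mulrDr -expr2 lerD2l.
  have -> : k%:R ^+ 2 * gamma * n ^+ 2 = n * (k%:R ^+ 2 * gamma * n) by ring.
  by apply: ler_pM; rewrite ?mulr_ge0 // !ler_wpM2r.
have rB : delta_run i m * B <= delta_run i m * (b ^+ 2 + k%:R ^+ 2 * gamma * n ^+ 2).
  by rewrite ler_wpM2l.
set W := b ^+ 2 + _ in rB *; move=> IH.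
(* With [r = delta_run i m] and [w = walk_rate i i m], the coefficient of [W] becomes
   [(1 - r) * (1 - w) + r = 1 - w * (1 - r)], as required for the next rate. *)
have : (1 - delta_run i m) * v ^+ 2 <= (1 - delta_run i m) *
   (walk_rate i i m * n ^+ 2 + (1 - walk_rate i i m) * W +
     (m - i)%:R * k%:R * gamma * n ^+ 2) by rewrite ler_wpM2l ?subr_ge0.
have : 0 <= delta_run i m * ((m - i)%:R * k%:R * gamma * n ^+ 2).
  by rewrite !mulr_ge0 ?sqr_ge0.
lra.
Qed.

End Walk.

(** * Lower bound on the rate from non-laziness *)

Section Mass.
Context (R : realType) (disp : Order.disp_t) (X : finPOrderType disp)
  (P : regular_poset R X).
Local Notation V := {ffun X -> R^o}.
Implicit Types (f g h : V) (i k l m : nat) (a b : R) (x y : X).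

(** [U] averages over covered faces, so a support inside the up-set of [x] stays there. *)
Lemma Upow_eq0 k l f x : (forall y, ~~ (x <= y)%O -> f y = 0) ->
  forall y, ~~ (x <= y)%O -> Upow P k l f y = 0.
Proof.
rewrite /Upow; elim: (iota _ _) f => //= i s IHs f f0; apply: IHs => y nxy.
rewrite ffunE; case: ifP => // _; rewrite big1 ?mulr0 // => z /andP[/ltW zy _].
by apply: f0; apply: contraNN nxy => /le_trans; apply.
Qed.

(** The indicators of the faces of rank [l] add up to the constant 1, which [U] preserves. *)
Lemma sum_Upow_indicator k l y : (l <= k <= pdim P)%N -> rk P y = k ->
  \sum_(x | rk P x == l) Upow P k l (indicator R x) y = 1.
Proof.
move=> le_lk ry.
have <- : level_one P k y = 1 by rewrite level_oneE ry eqxx.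
rewrite -(Upow_level_one le_lk).
have -> : level_one P l = \sum_(x | rk P x == l) (indicator R x : V).
  apply/ffunP => z; rewrite level_oneE sum_ffunE.
  case: eqP => rz.
    rewrite (bigD1 z) ?rz //= ffunE eqxx big1 ?addr0 // => x /andP[_ /negbTE xz].
    by rewrite ffunE eq_sym xz.
  rewrite big1 // => x /eqP rx; rewrite ffunE.
  by case: eqP rz => // ->; rewrite rx.
by rewrite (linear_bigsum (Upow_is_linear P k l)) sum_ffunE.
Qed.

(** The total weight of a level is [<1, 1>], which adjointness carries to the top level. *)
Lemma sum_weight k : (k <= pdim P)%N -> \sum_(x | rk P x == k) wt P x = 1.
Proof.
have ip1 m : ip P m (level_one P m) (level_one P m) = \sum_(x | rk P x == m) wt P x.
  by apply: eq_bigr => x /eqP rx; rewrite level_oneE rx eqxx !mulr1.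
move=> le_k; have le_kd : (k <= pdim P <= pdim P)%N by rewrite le_k /=.
rewrite -ip1 -{2}(Dpow_level_one le_kd) -Upow_adjoint // Upow_level_one // ip1.
exact: wt_sum1.
Qed.

Lemma indicator_id x : indicator R x x = 1.
Proof. by rewrite ffunE eqxx. Qed.

Lemma ip_indicator k x f : rk P x = k -> ip P k f (indicator R x) = wt P x * f x.
Proof.
move=> rx; rewrite /ip (bigD1 x) ?rx //= ffunE eqxx mulr1 big1 ?addr0 // => y.
by case/andP=> _ /negbTE yx; rewrite ffunE yx mulr0.
Qed.

(** For fixed [y], the values [U^k_l 1_x y] sum to 1 and vanish unless [x <= y], which leaves
    [reg P k l] of them. Cauchy-Schwarz bounds the sum of their squares, and averaging over [y]
    concludes. *)
Lemma sum_sqr_nrm_Upow_indicator k l : (l <= k <= pdim P)%N ->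
  (reg P k l)%:R^-1 <= \sum_(x | rk P x == l) nrm P k (Upow P k l (indicator R x)) ^+ 2.
Proof.
move=> /andP[le_l le_k]; have le_lk : (l <= k <= pdim P)%N by rewrite le_l.
under eq_bigr do rewrite sqr_nrm //.
rewrite exchange_big /= -[leLHS]mulr1 -[X in _ * X](sum_weight le_k) mulr_sumr.
apply: ler_sum => y /eqP ry.
rewrite [leRHS](eq_bigr (fun x => wt P y * Upow P k l (indicator R x) y ^+ 2)); last first.
  by move=> x _; rewrite expr2 mulrA.
rewrite -mulr_sumr [leLHS]mulrC ler_pM2l ?weight_gt0 ?ry //.
pose p x := Upow P k l (indicator R x) y.
rewrite -[leRHS]/(\sum_(x | rk P x == l) p x ^+ 2).
have p0 x : (rk P x == l) && ~~ (x <= y)%O -> p x = 0.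
  case/andP=> _; apply: Upow_eq0 => z; rewrite ffunE.
  by case: eqP => // ->; rewrite lexx.
have : \sum_(x | rk P x == l) p x = 1 := sum_Upow_indicator le_lk ry.
rewrite (bigID (fun x => (x <= y)%O)) /= [X in _ + X]big1 ?addr0 // => p1.
have := sqr_sum_le (fun x => (rk P x == l) && (x <= y)%O) p.
rewrite {}p1 expr1n -{1}ry regP ?ry // => le1.
rewrite (bigID (fun x => (x <= y)%O)) /= [X in _ + X]big1 ?addr0; last first.
  by move=> x /p0 ->; rewrite expr0n.
have r_gt0 : 0 < (reg P k l)%:R :> R by rewrite ltr0n reg_le_gt0.
by rewrite -(ler_pM2l r_gt0) mulfV ?gt_eqF.
Qed.

(** By adjointness [|D 1_x|^2 = <U D 1_x, 1_x>], the weight of [x] times its laziness. *)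
Lemma sqr_nrm_Dop_indicator (gamma : R) i x : non_lazy P gamma ->
  (0 < i <= pdim P)%N -> rk P x = i ->
  nrm P i.-1 (Dop P i (indicator R x)) ^+ 2 <= gamma * nrm P i (indicator R x) ^+ 2.
Proof.
move=> lazy /andP[i0 le_i] rx; rewrite !sqr_nrm //; last by lia.
case: i i0 le_i rx => // i _ lt_i rx.
rewrite -Uop_adjoint // !ip_indicator // indicator_id mulr1 mulrC.
by rewrite ler_wpM2r ?(lazy i.+1) // ltW ?weight_gt0 ?rx.
Qed.

Lemma reg_le_Rmax k i : (i <= k)%N -> (reg P k i <= Rmax P k)%N.
Proof.
by move=> le_i; apply: (leq_bigmax (Ordinal (le_i : (i < k.+1)%N))).
Qed.

Lemma Rmax_gt0 k : (k <= pdim P)%N -> (0 < Rmax P k)%N.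
Proof.
move=> le_k; apply: leq_trans (reg_le_Rmax (leqnn k)).
by rewrite reg_le_gt0 // leqnn.
Qed.

Lemma non_lazy_ge0 (gamma : R) : non_lazy P gamma -> (0 < pdim P)%N -> 0 <= gamma.
Proof.
move=> lazy d_gt0; have [x rx] := exists_rk d_gt0.
have := sqr_nrm_Dop_indicator lazy (d_gt0 : (0 < 1 <= _)%N) rx.
move/(le_trans (sqr_ge0 _)); rewrite pmulr_lge0 //.
by rewrite sqr_nrm // ip_indicator // indicator_id mulr1 weight_gt0 ?rx.
Qed.

Lemma sum_sqr_nrm_indicator k : (k <= pdim P)%N ->
  \sum_(x | rk P x == k) nrm P k (indicator R x) ^+ 2 = 1.
Proof.
move=> le_k; rewrite -(sum_weight le_k); apply: eq_bigr => x /eqP rx.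
by rewrite sqr_nrm // ip_indicator // indicator_id mulr1.
Qed.

(** Each [|U^k_j 1_x|^2] is at most the right side times [|1_x|^2], and the [|1_x|^2] sum to 1. The
    3 counts the laziness term, the cross term and the accumulated step errors, each at most
    [k^2 gamma |1_x|^2]. *)
Lemma walk_rate_ge (delta : nat -> R) (gamma : R) j k :
  eposet P delta gamma -> non_lazy P gamma -> (0 < j <= k)%N -> (k <= pdim P)%N ->
  (reg P k j)%:R^-1 <= walk_rate delta j j k + 3 * k%:R ^+ 2 * gamma.
Proof.
move=> ep lazy /andP[j0 jk] le_k.
have gamma_ge0 : 0 <= gamma by apply: non_lazy_ge0 lazy _; lia.
have le_j := leq_trans jk le_k.
have le_jk : (j <= k <= pdim P)%N by rewrite jk.
apply: le_trans (sum_sqr_nrm_Upow_indicator le_jk) _.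
rewrite -[leRHS]mulr1 -[X in _ <= _ * X](sum_sqr_nrm_indicator le_j) mulr_sumr.
apply: ler_sum => x /eqP rx.
have j0k : (0 < j <= k)%N by rewrite j0.
have le_kkd : (k <= k <= pdim P)%N by rewrite leqnn.
apply: le_trans (sqr_nrm_Upow_le ep gamma_ge0 _ j0k le_kkd) _.
have j0d : (0 < j <= pdim P)%N by rewrite j0.
have := sqr_nrm_Dop_indicator lazy j0d rx.
have /andP[r0 r1] := walk_rate_bounds ep j j le_k.
have k1 : 1 <= k%:R ^+ 2 :> R by rewrite -natrX ler1n expn_gt0; lia.
have kj : (k - j)%:R * k%:R <= k%:R ^+ 2 :> R.
  by rewrite expr2 ler_wpM2r // ler_nat leq_subr.
set D2 := nrm P j.-1 _ ^+ 2; set n2 := nrm P j _ ^+ 2; set K := k%:R ^+ 2 in k1 kj *.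
have D0 : 0 <= D2 by exact: sqr_ge0.
have t0 : 0 <= gamma * n2 by rewrite mulr_ge0 ?sqr_ge0.
move=> le_D; rewrite [leRHS]mulrDl -!(mulrA _ gamma).
set t := gamma * n2 in t0 le_D *.
have Kt : t <= K * t by rewrite ler_peMl.
have : (k - j)%:R * k%:R * t <= K * t by rewrite ler_wpM2r.
have : (1 - walk_rate delta j j k) * (D2 + K * t) <= D2 + K * t.
  by rewrite ler_piMl //; lra.
lra.
Qed.

End Mass.

(** Substituting [m = k - s] reverses the product; [j <= l] keeps the index [m - j] nonnegative. *)
Lemma lambda_lowerE (R : realType) (delta : nat -> R) (k l j : nat) :
  (j <= l)%N -> lambda_lower delta k l j = walk_rate delta j l k.
Proof.
move=> jl; rewrite /lambda_lower /walk_rate big_add1 /= -{2}[l]add0n big_addn.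
rewrite big_nat_rev; apply: eq_big_nat => s /andP[_ lt_s].
have -> : (k - (0 + (k - l) - s.+1).+1 = s + l)%N by lia.
have le_j : (j <= s + l)%N by lia.
by rewrite /delta_prod subzn // /delta_run subKn.
Qed.

Lemma max_delta_le1 (R : realType) (delta : nat -> R) (d : nat) :
  (forall i, (i < d)%N -> 0 <= delta i <= 1) -> max_delta delta d <= 1.
Proof.
move=> delta01; rewrite /max_delta big_nat_cond.
elim/big_ind: _ => [|x y|i /andP[/andP[_ lt_i] _]]; first exact: ler01.
  by rewrite ge_max => -> ->.
have := delta01 _ lt_i; have /delta01 : (i.-1 < d)%N by lia.
by move=> /andP[? ?] /andP[? ?]; rewrite mulr_ile1 ?subr_ge0 //; lra.
Qed.

(** * Variance of a decomposed function *)

Section Main.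
Context (R : realType) (disp : Order.disp_t) (X : finPOrderType disp)
  (P : regular_poset R X) (k : nat) (le_k : (k <= pdim P)%N).
Local Notation V := {ffun X -> R^o}.
Context (f : V) (fs gs : nat -> V).
Hypotheses (gs_ker : forall i, (i <= k)%N -> Hi P i (gs i))
  (fsE : forall i, (i <= k)%N -> fs i = Upow P k i (gs i))
  (f_sum : f = \sum_(i < k.+1) fs i).

(** This includes [i = 0], where no face passes the rank test of [Dop]. *)
Lemma Dop_gs i : (i <= k)%N -> Dop P i (gs i) = 0 :> V.
Proof.
case: i => [|i] le_i.
  by apply/ffunP => x; rewrite !ffunE.
by have [_ ->] := gs_ker le_i.
Qed.

Lemma expectation_ip m g : expectation P m g = ip P m (level_one P m) g.
Proof.
by apply: eq_bigr => x /eqP rx; rewrite level_oneE rx eqxx mulr1.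
Qed.

Lemma constant_part :
  fs 0%N = expectation P k f *: level_one P k.
Proof.
have [C0 _] := gs_ker (leq0n k).
have [c gE] := rank0_constant P (gs 0%N).
have g0E : gs 0%N = c *: level_one P 0.
  apply/ffunP => x; have [/gE //|/eqP n0] := eqVneq (rk P x) 0%N.
  by rewrite C0 // ffunE level_oneE; case: eqP => // _; rewrite scaler0.
(* Exactly, not only approximately: adjointness reduces the pairing to
   [<g_i, 1> = <g_i, U 1> = <D g_i, 1> = 0]. *)
have one_orth i : (0 < i <= k)%N -> ip P k (level_one P k) (fs i) = 0.
  case: i => // i /andP[_ lt_i]; have le_i := leq_trans lt_i le_k.
  have le_id : (i < k <= pdim P)%N by rewrite lt_i.
  rewrite (fsE lt_i) ipC Upow_adjoint // Dpow_level_one // ipC.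
  by rewrite -Uop_level_one // Uop_adjoint // Dop_gs // ip0r.
have le_0k : (0 <= k <= pdim P)%N by rewrite le_k.
have f0E : fs 0%N = c *: level_one P k.
  by rewrite (fsE (leq0n k)) g0E UpowZ Upow_level_one.
rewrite f0E expectation_ip f_sum ip_sumr big_ord_recl /= big1 ?addr0; last first.
  by move=> i _; rewrite one_orth //= /bump /= add1n ltn_ord.
rewrite f0E ipZr -expectation_ip /expectation.
rewrite (eq_bigr (wt P)); last first.
  by move=> x /eqP rx; rewrite level_oneE rx eqxx mulr1.
by rewrite sum_weight // mulr1.
Qed.

(** Centring [D^k_l f] amounts to removing [D^k_l f_0], by [constant_part]. *)
Lemma variance_Dpow l : (l <= k)%N ->
  variance P l (Dpow P k l f)
    = \sum_(1 <= j < k.+1) ip P l (Dpow P k l f) (Dpow P k l (fs j)).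
Proof.
move=> le_l; have le_ld := leq_trans le_l le_k.
have le_lk : (l <= k <= pdim P)%N by rewrite le_l.
set h : V := Dpow P k l f; set E := expectation P l h.
have E_k : E = expectation P k f.
  by rewrite /E !expectation_ip -Upow_adjoint // Upow_level_one.
have one1 : ip P l (level_one P l) (level_one P l) = 1.
  rewrite -expectation_ip -(sum_weight le_ld); apply: eq_bigr => x /eqP rx.
  by rewrite level_oneE rx eqxx mulr1.
have -> : variance P l h = ip P l (h - E *: level_one P l) (h - E *: level_one P l).
  apply: eq_bigr => x /eqP rx; rewrite -mulrA -expr2; congr (_ * _ ^+ 2).
  rewrite -/E; move: h E {E_k} => h E.
  by rewrite !ffunE rx eqxx scaleoE mulr1.
(* The centred function is orthogonal to 1, so the left argument may be taken to be [h] itself. *)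
rewrite ipBl ipZl [ip P l (level_one P l) _]ipBr ipZr one1.
rewrite -expectation_ip -/E mulr1 subrr mulr0 subr0.
rewrite -ip_sumr; congr (ip P l h _).
rewrite -(linear_bigsum (Dpow_is_linear P k l)).
rewrite -(Dpow_level_one le_lk) -DpowZ -DpowB E_k -constant_part; congr (Dpow P k l _).
by rewrite f_sum big_ord_recl addrC addKr big_add1 big_mkord.
Qed.

(** * Error term and near-orthogonality of the components *)

Context (delta : nat -> R) (gamma : R).
Hypotheses (ep : eposet P delta gamma) (gamma_ge0 : 0 <= gamma).

(** For [j <= l], [<f, f_j> = <D^k_l f, U^l_j g_j>], so [walk_on_kernel] compares the two terms; for
    [j > l] there is no main term and [walk_below_kernel] applies. *)
Lemma variance_error l : (l <= k)%N ->
  `|variance P l (Dpow P k l f)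
    - \sum_(1 <= j < l.+1) lambda_lower delta k l j * ip P k f (fs j)|
  <= k%:R ^+ 2 * gamma * nrm P k f * \sum_(1 <= j < k.+1) nrm P j (gs j).
Proof.
move=> le_l; have le_ld := leq_trans le_l le_k.
have le_lk : (l <= k <= pdim P)%N by rewrite le_l.
rewrite variance_Dpow // !(@big_cat_nat _ _ _ l.+1 1 k.+1) //=.
rewrite addrAC -sumrB mulrDr; set h : V := Dpow P k l f.
have hf : nrm P l h <= nrm P k f by exact: nrm_Dpow.
have ip_h_le (e : V) b : nrm P l e <= k%:R ^+ 2 * gamma * b ->
    `|ip P l h e| <= k%:R ^+ 2 * gamma * nrm P k f * b.
  move=> le_e; apply: le_trans (cauchy_schwarz _ _ le_ld) _.
  rewrite mulrAC [leRHS]mulrC; apply: ler_pM => //; exact: nrm_ge0.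
apply: le_trans (ler_normD _ _) _; apply: lerD.
  apply: le_trans (ler_norm_sum _ _ _) _; rewrite mulr_sumr.
  apply: ler_sum_nat => j /andP[j0 jl].
  have jl' : (j <= l)%N by [].
  have jk := leq_trans jl' le_l.
  have jlk : (j <= l <= k)%N by rewrite jl'.
  have -> : ip P k f (fs j) = ip P l h (Upow P l j (gs j)).
    rewrite ipC [RHS]ipC -Upow_adjoint // -(Upow_comp P _ jlk) //.
    by rewrite ipC (fsE jk) [RHS]ipC.
  rewrite lambda_lowerE // -ipZr -ipBr (fsE jk); apply: ip_h_le.
  apply: le_trans (walk_on_kernel ep gamma_ge0 jlk le_k (Dop_gs jk)) _.
  rewrite expr2 !ler_wpM2r ?nrm_ge0 // ler_nat leq_subr //.
apply: le_trans (ler_norm_sum _ _ _) _; rewrite mulr_sumr.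
apply: ler_sum_nat => j /andP[lj jk]; have jk' : (j <= k)%N by [].
rewrite (fsE jk'); apply: ip_h_le.
by apply: (walk_below_kernel ep gamma_ge0 _ le_k (Dop_gs jk')); rewrite lj.
Qed.

Hypotheses (lazy : non_lazy P gamma) (k_gt0 : (0 < k)%N).
Let K : R := k%:R.
Let Q : R := (Rmax P k)%:R.
Hypothesis gamma_small : gamma * (K ^+ 5 * Q ^+ 2) <= 16^-1.

Let K_ge1 : 1 <= K. Proof. by rewrite ler1n. Qed.
Let Q_ge1 : 1 <= Q. Proof. by rewrite ler1n Rmax_gt0. Qed.

(** The spare factor [K ^+ 2 * Q] is at least 1. The cube serves the off-diagonal terms, which cost
    one more [K] than the diagonal ones. *)
Lemma gamma_le : K ^+ 3 * gamma <= 16^-1 * Q^-1.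
Proof.
have K0 := le_trans ler01 K_ge1; have Q0 := le_trans ler01 Q_ge1.
rewrite ler_pdivlMr; last exact: lt_le_trans ltr01 Q_ge1.
apply: le_trans gamma_small.
have -> : gamma * (K ^+ 5 * Q ^+ 2) = (K ^+ 3 * gamma * Q) * (K ^+ 2 * Q) by ring.
rewrite ler_peMr ?mulr_ge0 ?exprn_ge0 //.
by rewrite -[1]mulr1 ler_pM // expr_ge1.
Qed.

Lemma sqr_gamma_le : K ^+ 2 * gamma <= 16^-1 * Q^-1.
Proof.
apply: le_trans gamma_le; rewrite ler_wpM2r // [leRHS]exprS ler_peMl //.
by rewrite exprn_ge0 // (le_trans ler01).
Qed.

Lemma walk_rate_ge_Rmax j : (j <= k)%N ->
  Q^-1 - 3 * (K ^+ 2 * gamma) <= walk_rate delta j j k.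
Proof.
have Q_gt0 : 0 < Q by exact: lt_le_trans ltr01 Q_ge1.
have T0 : 0 <= K ^+ 2 * gamma by rewrite mulr_ge0 // exprn_ge0 // (le_trans ler01).
case: (posnP j) => [->|j0] jk.
  rewrite /walk_rate big_nat big1 => [|m _].
    have Q_le1 : Q^-1 <= 1 by rewrite invf_le1.
    lra.
  (* For [j = 0] every run contains [delta 0 = 0], so the rate is 1. *)
  by case: ep => d0 _ _; rewrite /delta_run big_ltn // d0 mul0r subr0.
have j0k : (0 < j <= k)%N by rewrite j0.
have := walk_rate_ge ep lazy j0k le_k.
have : Q^-1 <= (reg P k j)%:R^-1.
  rewrite lef_pV2 ?posrE ?ler_nat ?reg_le_Rmax // ltr0n.
  by rewrite reg_le_gt0 // jk.
rewrite -/K; lra.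
Qed.

(** [|f_j|^2 = <g_j, D^k_j U^k_j g_j>] is the rate times [|g_j|^2] up to [K^2 gamma |g_j|^2]. In all
    [4 K^2 gamma] is lost from [Q^-1], that is at most a quarter. *)
Lemma sqr_nrm_component_ge j : (j <= k)%N ->
  3 / 4 * Q^-1 * nrm P j (gs j) ^+ 2 <= ip P k (fs j) (fs j).
Proof.
move=> jk; have jkd : (j <= k <= pdim P)%N by rewrite jk.
have jjk : (j <= j <= k)%N by rewrite leqnn.
have jd := leq_trans jk le_k.
rewrite (fsE jk) Upow_adjoint //.
have := walk_on_kernel ep gamma_ge0 jjk le_k (Dop_gs jk).
rewrite Upow_id; set e : V := _ - _; move=> le_e.
have -> : Dpow P k j (Upow P k j (gs j)) = walk_rate delta j j k *: gs j + e :> V.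
  by rewrite addrC subrK.
rewrite ipDr ipZr -sqr_nrm //.
have n0 := nrm_ge0 P j (gs j).
have : `|ip P j (gs j) e| <= K ^+ 2 * gamma * nrm P j (gs j) ^+ 2.
  apply: le_trans (cauchy_schwarz _ _ jd) (le_trans (ler_wpM2l n0 le_e) _).
  rewrite mulrCA -expr2 -!mulrA expr2 !mulrA !ler_wpM2r ?sqr_ge0 //.
  by rewrite ler_nat leq_subr.
have := walk_rate_ge_Rmax jk; have := sqr_gamma_le.
rewrite ler_norml; move: (K ^+ 2 * gamma) (walk_rate _ _ _ _) (ip P j _ _) => T w A.
set n2 := _ ^+ 2; have n20 : 0 <= n2 := sqr_ge0 _.
move=> le_T le_w /andP[le_A _].
have : (3 / 4 * Q^-1 + T) * n2 <= w * n2 by rewrite ler_wpM2r //; lra.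
lra.
Qed.

(** For [i < j], moving [U^k_i] across takes [f_j] below its kernel level. *)
Lemma ip_components_le i j : (i <= k)%N -> (j <= k)%N -> i != j ->
  `|ip P k (fs i) (fs j)| <= K ^+ 2 * gamma * nrm P i (gs i) * nrm P j (gs j).
Proof.
wlog lt_ij : i j / (i < j)%N => [IH ik jk|ik jk _].
  rewrite neq_ltn => /orP[lt_ij|lt_ji]; first by rewrite IH // ltn_eqF.
  by rewrite ipC mulrAC IH // ltn_eqF.
have ikd : (i <= k <= pdim P)%N by rewrite ik.
have ijk : (i < j <= k)%N by rewrite lt_ij.
rewrite (fsE ik) Upow_adjoint // (fsE jk).
apply: le_trans (cauchy_schwarz _ _ (leq_trans ik le_k)) _.
rewrite [leRHS]mulrAC [leRHS]mulrC ler_wpM2l ?nrm_ge0 //.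
exact: (walk_below_kernel ep gamma_ge0 ijk le_k (Dop_gs jk)).
Qed.

(** Expanding [|f|^2] over pairs of components, the diagonal is bounded below by
    [sqr_nrm_component_ge] and the rest by [ip_components_le]. Cauchy-Schwarz over [k + 1 <= 2 * K]
    terms yields the factor [sqrt K]. *)
Lemma sum_nrm_kernel_le :
  \sum_(j < k.+1) nrm P j (gs j) <= 2 * Num.sqrt K * Q * nrm P k f.
Proof.
set S := \sum_(j < k.+1) _; pose n (j : 'I_k.+1) := nrm P j (gs j).
pose N := \sum_j n j ^+ 2.
have Q_gt0 : 0 < Q by exact: lt_le_trans ltr01 Q_ge1.
have n0 j : 0 <= n j by exact: nrm_ge0.
have S0 : 0 <= S by apply: sumr_ge0 => j _; exact: n0.
have le_f : 3 / 4 * Q^-1 * N - K ^+ 2 * gamma * S ^+ 2 <= nrm P k f ^+ 2.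
  rewrite sqr_nrm // {1}f_sum ip_suml [leRHS](_ : _ =
    \sum_(i < k.+1) \sum_(j < k.+1) ip P k (fs i) (fs j)); last first.
    by apply: eq_bigr => i _; rewrite f_sum ip_sumr.
  rewrite [S ^+ 2]expr2 {1}/S mulr_suml !mulr_sumr -sumrB; apply: ler_sum => i _.
  have le_i : (i <= k)%N by rewrite -ltnS.
  rewrite [leRHS](bigD1 i) //= /S (bigD1 i) //= -/(n i).
  set B := \sum_(j < _ | _) ip _ _ _ _; set Si := \sum_(j < _ | _) nrm _ _ _.
  have : - B <= K ^+ 2 * gamma * n i * Si.
    rewrite /B /Si -sumrN mulr_sumr; apply: ler_sum => j ji.
    apply: le_trans (ler_norm _) _; rewrite normrN.
    have le_j : (j <= k)%N by rewrite -ltnS.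
    have ij : i != j :> nat by rewrite eq_sym.
    exact: (ip_components_le le_i le_j ij).
  have := sqr_nrm_component_ge le_i; rewrite -/(n i).
  have : 0 <= K ^+ 2 * gamma * n i ^+ 2.
    by rewrite !mulr_ge0 ?sqr_ge0 // exprn_ge0 // (le_trans ler01).
  lra.
have le_S : S ^+ 2 <= 2 * K * N.
  have := sqr_sum_le predT n; rewrite -/N card_ord => /le_trans; apply.
  rewrite ler_wpM2r ?sumr_ge0 // => [j _|]; first exact: sqr_ge0.
  rewrite -natr1; have := K_ge1; rewrite /K; lra.
have N0 : 0 <= N by apply: sumr_ge0 => j _; exact: sqr_ge0.
rewrite -(ler_pXn2r (_ : 0 < 2)%N) ?nnegrE ?mulr_ge0 ?sqrtr_ge0 ?nrm_ge0 ?(ltW Q_gt0) //.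
rewrite !exprMn sqr_sqrtr ?(le_trans ler01) //.
(* The off-diagonal error is absorbed: [3/4 - 1/8 = 5/8] of [Q^-1 * N] remains. *)
have : K ^+ 2 * gamma * S ^+ 2 <= 8^-1 * Q^-1 * N.
  apply: le_trans (_ : K ^+ 2 * gamma * (2 * K * N) <= _).
    by rewrite ler_wpM2l // mulr_ge0 // exprn_ge0 // (le_trans ler01).
  have -> : K ^+ 2 * gamma * (2 * K * N) = 2 * N * (K ^+ 3 * gamma) by ring.
  have -> : 8^-1 * Q^-1 * N = 2 * N * (16^-1 * Q^-1) by field; rewrite gt_eqF.
  by rewrite ler_wpM2l ?gamma_le // mulr_ge0.
move=> le_T; have {le_T}le_N : Q^-1 * N <= 2 * nrm P k f ^+ 2.
  have : 0 <= Q^-1 * N by rewrite mulr_ge0 // invr_ge0 ltW.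
  lra.
apply: le_trans le_S _.
have {}le_N : N <= 2 * Q * nrm P k f ^+ 2.
  by move: le_N; rewrite ler_pdivrMl //; lra.
apply: le_trans (ler_wpM2l _ le_N) _; first by rewrite mulr_ge0 // (le_trans ler01).
(* The estimate so far has [sqrt Q]; [Q >= 1] relaxes it to [Q]. *)
have -> : 2 ^+ 2 * K * Q ^+ 2 * nrm P k f ^+ 2 = Q * (2 * K * (2 * Q * nrm P k f ^+ 2)).
  by ring.
by rewrite ler_peMl // !mulr_ge0 ?nrm_ge0 ?(ltW Q_gt0) // (le_trans ler01).
Qed.

End Main.

(** * Choice of the kernel functions and of the constants *)

Lemma HD_level_set_choice (R : realType) (disp : Order.disp_t)
    (X : finPOrderType disp) (P : regular_poset R X) (k : nat)
    (f : {ffun X -> R}) (fs : nat -> {ffun X -> R}) :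
  HD_level_set_decomposition P k f fs ->
  exists gs : nat -> {ffun X -> R}, forall i, (i <= k)%N ->
    Hi P i (gs i) /\ fs i = Upow P k i (gs i).
Proof.
case=> fsV _.
have /choice[gs gsP] : forall i, exists g, (i <= k)%N ->
    Hi P i g /\ fs i = Upow P k i g.
  move=> i; have [le_i|_] := leqP i k; last by exists [ffun=> 0].
  by have [g Hg fE] := fsV i le_i; exists g.
by exists gs.
Qed.

(** The square comes from the walk errors, the root from [sum_nrm_kernel_le]. *)
Lemma powR_five_halves (R : realType) (x : R) : 0 < x ->
  x `^ (5 / 2) = x ^+ 2 * Num.sqrt x.
Proof.
move=> x_gt0; rewrite (_ : 5 / 2 = 2%:R + 2^-1); last by field.
rewrite powRD; last by rewrite (gt_eqF x_gt0) implybT.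
by rewrite powR_mulrn ?powR12_sqrt ?ltW.
Qed.

(* a and C are the absolute constants of the two O(.); the bound on gamma is
   multiplied out, so that it does not divide by k ^ 5 when k = 0. *)
Theorem theorem5p3 (R : realType) :
  exists a C : R, [/\ 0 < a, 0 < C &
    forall (disp : Order.disp_t) (X : finPOrderType disp)
           (P : regular_poset R X) (k : nat), (k <= pdim P)%N ->
    exists2 c : R, c <= C * k%:R `^ (5 / 2) * (Rmax P k)%:R &
    forall (delta : nat -> R) (gamma : R),
      eposet P delta gamma ->
      non_lazy P gamma ->
      gamma * (k%:R ^+ 5 * (Rmax P k)%:R ^+ 2) <= a * max_delta delta (pdim P) ->
    forall (f : {ffun X -> R}) (fs : nat -> {ffun X -> R}),
      Ck P k f ->
      HD_level_set_decomposition P k f fs ->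
    forall l : nat, (l <= k)%N ->
      `|variance P l (Dpow P k l f)
        - \sum_(1 <= j < l.+1) lambda_lower delta k l j * ip P k f (fs j)|
      <= c * gamma * nrm P k f ^+ 2].
Proof.
exists 16^-1, 2; split=> [||disp X P k le_k]; rewrite ?invr_gt0 ?ltr0n //.
have [k0|k_gt0] := posnP k.
  (* For [k = 0] both sums are empty, so [c = 0] works whatever the sign of [gamma]. *)
  subst k; exists 0; first by rewrite !mulr_ge0 ?powR_ge0.
  move=> delta gamma _ _ _ f fs _ dec l; rewrite leqn0 => /eqP ->.
  have [gs gsP] := HD_level_set_choice dec.
  rewrite (variance_Dpow le_k (fun i ik => (gsP i ik).1) (fun i ik => (gsP i ik).2)
    dec.2) //.
  by rewrite !big_geq // subrr normr0 !mul0r.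
exists (2 * k%:R `^ (5 / 2) * (Rmax P k)%:R) => //.
move=> delta gamma ep lazy small f fs _ dec l le_l.
have gamma_ge0 : 0 <= gamma by apply: non_lazy_ge0 lazy _; exact: leq_trans le_k.
have {}small : gamma * (k%:R ^+ 5 * (Rmax P k)%:R ^+ 2) <= 16^-1.
  apply: le_trans small _; rewrite ger_pMr ?invr_gt0 ?ltr0n //.
  by apply: max_delta_le1 => i; apply: (delta_bounds ep).
have [gs gsP] := HD_level_set_choice dec.
have ker i ik := (gsP i ik).1; have fsE i ik := (gsP i ik).2.
apply: le_trans (variance_error le_k ker fsE dec.2 ep gamma_ge0 le_l) _.
have := sum_nrm_kernel_le le_k ker fsE dec.2 ep gamma_ge0 lazy k_gt0 small.
rewrite -(big_mkord predT (fun j => nrm P j (gs j))) big_ltn // => le_S.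
(* The nonnegative term [j = 0] is dropped, as the error sum starts at 1. *)
have {}le_S := le_trans (ler_wpDl (nrm_ge0 P 0 (gs 0%N)) (lexx _)) le_S.
have T0 : 0 <= k%:R ^+ 2 * gamma * nrm P k f.
  by rewrite !mulr_ge0 ?exprn_ge0 ?nrm_ge0.
apply: le_trans (ler_wpM2l T0 le_S) _.
rewrite powR_five_halves ?ltr0n // le_eqVlt; apply/orP; left; apply/eqP.
ring.
Qed.
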